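(* Let $P(z)=\sum_{j=0}^mz^jA_j$, $A_j\in\mathbb C^{n\times n}$, be a regular $H$-palindromic matrix polynomial, and let $\mathbb S_p$ be the set of $H$-palindromic matrix polynomials $\sum_{j=0}^mz^jB_j$ with $B_j\in\mathbb C^{n\times n}$. Let $L\in\mathbb L_1(P)$ be either an $H$-palindromic linearization of $P$ with right ansatz vector $v\in\mathbb C^m$ satisfying $Rv=\overline v$, or an $H$-anti-palindromic linearization of $P$ with right ansatz vector $v\in\mathbb C^m$ satisfying $Rv=-\overline v$; in both cases $\|v\|_2=1$. Let $\mathbb S$ denote correspondingly the $H$-palindromic or $H$-anti-palindromic structure of $mn\times mn$ pencils. Let $\lambda\in\mathbb C$ with $|\lambda|=1$, $x\in\mathbb C^n$ with $\|x\|_2=1$ and $P(\lambda)x\neq0$, and $\Lambda_{m-1}=[\lambda^{m-1},\dots,\lambda,1]^T$. Then $$\sqrt{\frac{m+1}{2m}}\le\frac{\eta_F^{\mathbb S}(\lambda,\Lambda_{m-1}\otimes x,L;v)}{\eta_F(\lambda,x,P)}\le\sqrt2,\qquad \frac{\eta_F^{\mathbb S}(\lambda,\Lambda_{m-1}\otimes x,L;v)}{\eta_F^{\mathbb S_p}(\lambda,x,P)}\le\sqrt2,$$ $$\sqrt{\frac{m+1}{2m}}\le\frac{\eta_2^{\mathbb S}(\lambda,\Lambda_{m-1}\otimes x,L;v)}{\eta_2(\lambda,x,P)}=\frac{\eta_2^{\mathbb S}(\lambda,\Lambda_{m-1}\otimes x,L;v)}{\eta_2^{\mathbb S_p}(\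lambda,x,P)}\le\sqrt2.$$
   Context: A matrix polynomial $\sum_{j=0}^m z^jA_j$ is $H$-palindromic if $A_j^H=A_{m-j}$ for all $j$; $H$-anti-palindromic if $A_j^H=-A_{m-j}$ for all $j$ ($^H$ is conjugate transpose). Thus a pencil $zX+Y$ is $H$-palindromic iff $Y=X^H$ and $H$-anti-palindromic iff $Y=-X^H$. Regular means $\det P(z)\ne0$ for some $z$. $\mathbb L_1(P)$ is the set of pencils $L(z)=zX+Y$, $X,Y\in\mathbb C^{mn\times mn}$, for which there is $v\in\mathbb C^m$ (the right ansatz vector) with $L(z)([z^{m-1},\dots,z,1]^T\otimes I_n)=v\otimes P(z)$ for all $z$. A pencil $L$ is a linearization of $P$ if $E(z)L(z)F(z)=\mathrm{diag}(P(z),I_{(m-1)n})$ for some matrix polynomials $E,F$ with nonzero constant determinants. $R$ is the $m\times m$ matrix with ones on the antidiagonal and zeros elsewhere. For a matrix polynomial $Q(z)=\sum_{j=0}^kz^jB_j$ and $M=F$ (Frobenius) or $M=2$ (spectral), $|\!|\!|Q|\!|\!|_M=\big(\sum_{j}\|B_j\|_M^2\big)^{1/2}$. The unstructured backward error is $\eta_M(\lambda,x,P)=\min\{|\!|\!|\Delta P|\!|\!|_M:P(\lambda)x+\Delta P(\lambda)x=0\}$ over all $\Delta P(z)=\sum_{j=0}^m z^j\Delta A_j$, $\Delta A_j\in\mathbb C^{n\times n}$; the structured one $\eta_M^{\mathbb S_p}(\lambda,x,P)$ is the same minimum over $\Delta P\in\mathbb S_p$. For nonzero $w\in\mathbb C^{mn}$,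 $\eta_M^{\mathbb S}(\lambda,w,L;v)$ is the minimum of $|\!|\!|\Delta L|\!|\!|_M$ over all pencils $\Delta L$ of size $mn\times mn$ with the same structure ($H$-palindromic or $H$-anti-palindromic) as $L$ such that $L(\lambda)w+\Delta L(\lambda)w=0$. *)

(* Defs.v *)
From HB Require Import structures.
From mathcomp Require Import all_boot all_order all_algebra.
From mathcomp Require Import all_classical all_reals.
From mathcomp Require Import complex mxtens.

Set Implicit Arguments.
Unset Strict Implicit.
Unset Printing Implicit Defensive.

Import Order.TTheory GRing.Theory Num.Theory.
Local Open Scope classical_set_scope.
Local Open Scope ring_scope.
Local Open Scope sesquilinear_scope.

(** Norms. The modulus [Normc.normc] is used instead of [`|_|] because
    the latter takes its values in [R[i]]. *)

Definition vnorm2 (R : realType) (n : nat) (u : 'cV[R[i]]_n) : R :=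
  Num.sqrt (\sum_(i < n) Normc.normc (u i 0) ^+ 2).

Definition frobenius_norm (R : realType) (n : nat) (B : 'M[R[i]]_n) : R :=
  Num.sqrt (\sum_(i < n) \sum_(j < n) Normc.normc (B i j) ^+ 2).

Definition spectral_norm (R : realType) (n : nat) (B : 'M[R[i]]_n) : R :=
  sup [set vnorm2 (B *m u) | u in [set u : 'cV[R[i]]_n | vnorm2 u = 1]].

(** A matrix polynomial sum_(j <= m) z^j Q_j of grade m (the leading
    coefficient may vanish) is its family of coefficients. A pencil z X + Y is
    a matrix polynomial of grade 1, with X = L ord_max and Y = L ord0. *)

Definition mxpol (R : realType) (m n : nat) : Type := 'I_m.+1 -> 'M[R[i]]_n.

Definition mxpol_eval (R : realType) (m n : nat) (Q : mxpol R m n) (z : R[i]) :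
  'M[R[i]]_n := \sum_(j < m.+1) z ^+ j *: Q j.

Definition mxpol_poly (R : realType) (m n : nat) (Q : mxpol R m n) :
  'M[{poly R[i]}]_n := \sum_(j < m.+1) 'X^j *: map_mx polyC (Q j).

Definition regular (R : realType) (m n : nat) (Q : mxpol R m n) : Prop :=
  exists z : R[i], \det (mxpol_eval Q z) != 0.

Definition Hpalindromic (R : realType) (m n : nat) : set (mxpol R m n) :=
  [set Q | forall j, Q j ^t* = Q (rev_ord j)].

Definition Hantipalindromic (R : realType) (m n : nat) : set (mxpol R m n) :=
  [set Q | forall j, Q j ^t* = - Q (rev_ord j)].

(** The vector [z^(m-1), ..., z, 1]^T. *)
Definition Lam (R : realType) (m : nat) (z : R[i]) : 'cV[R[i]]_m :=
  \col_(i < m) z ^+ (m.-1 - i).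

Definition flip_mx (R : realType) (m : nat) : 'M[R[i]]_m :=
  \matrix_(i, j) (j == rev_ord i)%:R.

(** L is in L_1(P) with right ansatz vector v. *)
Definition in_L1 (R : realType) (m n : nat) (P : mxpol R m n)
    (L : mxpol R 1 (m * n)) (v : 'cV[R[i]]_m) : Prop :=
  forall z : R[i],
    mxpol_eval L z *m (Lam m z *t (1%:M : 'M_n)) = v *t mxpol_eval P z.

Definition unimodular (R : realType) (n : nat) (E : 'M[{poly R[i]}]_n) : Prop :=
  exists2 c : R[i], c != 0 & \det E = c%:P.

(** For 0 < m, [pid_mx 1] = diag(1, 0, ..., 0) and [copid_mx 1] =
    diag(0, 1, ..., 1) in [ 'M_m ], so the right-hand side is
    diag(P(z), I_((m-1)n)), indexed by [ 'I_(m * n) ]. *)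
Definition linearization (R : realType) (m n : nat) (P : mxpol R m n)
    (L : mxpol R 1 (m * n)) : Prop :=
  exists E F : 'M[{poly R[i]}]_(m * n),
    [/\ unimodular E, unimodular F &
        E *m mxpol_poly L *m F =
        (pid_mx 1 : 'M_m) *t mxpol_poly P
        + (copid_mx 1 : 'M_m) *t (1%:M : 'M_n)].

Definition is_min (R : realType) (A : set R) (r : R) : Prop :=
  A r /\ lbound A r.

(** The minimum of A, with junk value 0 if A has no least element. *)
Definition minimum (R : realType) (A : set R) : R :=
  xget 0 [set r | is_min A r].

Lemma minimumE (R : realType) (A : set R) (r : R) :
  is_min A r -> minimum A = r.
Proof.
move=> Ar; apply: xget_unique => // s [As sA].
by case: Ar => Ar rA; apply/eqP; rewrite eq_le sA ?rA.
Qed.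

Definition mxpol_norm (R : realType) (m n : nat) (N : 'M[R[i]]_n -> R)
    (Q : mxpol R m n) : R :=
  Num.sqrt (\sum_(j < m.+1) N (Q j) ^+ 2).

(** Backward error of (lam, x) for Q in the matrix norm N, with perturbations
    restricted to S; [S = setT] gives the unstructured backward error. *)
Definition backward_error (R : realType) (m n : nat) (N : 'M[R[i]]_n -> R)
    (S : set (mxpol R m n)) (lam : R[i]) (x : 'cV[R[i]]_n) (Q : mxpol R m n) :
    R :=
  minimum [set mxpol_norm N D | D in
    [set D | S D /\ mxpol_eval Q lam *m x + mxpol_eval D lam *m x = 0]].

(* Main.v *)
(** Both backward errors reduce to a minimal-norm matrix equation [H w = s] with
    [s] a multiple of the residual [Q(lam) w]. Since |lam| = 1, a structured
    polynomial of grade m takes, up to a fixed unimodular factor, a Hermitian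
    value at [lam], and conversely every Hermitian matrix arises this way from
    m + 1 coefficients of equal norm; so the error is the minimal norm of a
    (Hermitian) solution divided by sqrt (m + 1). For a unit [w] that minimum is
    |s| in the spectral norm, with or without the Hermitian constraint
    (Householder reflection), and between |s| and sqrt 2 |s| in the Frobenius
    norm. The ansatz equation gives L(lam) (Lam *t x) = v *t P(lam) x, so P and
    L have residuals of equal norm while |Lam *t x| = sqrt m; the constants
    follow. *)

Require Import Defs.
From HB Require Import structures.
From mathcomp Require Import all_boot all_order all_algebra.
From mathcomp Require Import all_classical all_reals.
From mathcomp Require Import complex mxtens ring.

Set Implicit Arguments.
Unset Strict Implicit.
Unset Printing Implicit Defensive.

Import Order.TTheory GRing.Theory Num.Theory.
Local Open Scope classical_set_scope.
Local Open Scope ring_scope.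
Local Open Scope sesquilinear_scope.
Local Notation "r %:C" := (real_complex _ r) : ring_scope.

(** * Euclidean and Frobenius norms, adjoints and trace orthogonality *)

Section Norms.
Variable R : realType.
Implicit Types (m n : nat).
Notation C := R[i].
Notation normc := (@Normc.normc R).

Lemma norm_normc (z : C) : `|z| = (normc z)%:C.
Proof. by []. Qed.

Lemma normc_ge0 (z : C) : 0 <= normc z.
Proof. by rewrite -ler0c -norm_normc. Qed.

Lemma vnorm2_ge0 n (u : 'cV[C]_n) : 0 <= vnorm2 u.
Proof. exact: sqrtr_ge0. Qed.

Lemma sqr_vnorm2 n (u : 'cV[C]_n) : (vnorm2 u ^+ 2)%:C = (u^t* *m u) 0 0.
Proof.
rewrite sqr_sqrtr ?sumr_ge0 ?rmorph_sum ?mxE//= => [|i _]; last exact: sqr_ge0.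
by apply: eq_bigr => i _; rewrite !mxE rmorphXn /= -norm_normc mulrC normCK.
Qed.

Lemma vnorm2_eq0 n (u : 'cV[C]_n) : (vnorm2 u == 0) = (u == 0).
Proof.
apply/eqP/eqP => [u0|->].
  apply: trmx_inj; apply/eqP; rewrite trmx0 -(dnorm_eq0 (@dotmx C n)) /=.
  have := sqr_vnorm2 u; rewrite u0 expr0n /= => uu.
  rewrite dotmxE; apply/eqP; transitivity ((u^t* *m u) 0 0); last exact/esym/uu.
  by rewrite !mxE; apply: eq_bigr => i _; rewrite !mxE mulrC.
by apply/eqP; rewrite -sqrf_eq0 -(inj_eq (@complexI R)) sqr_vnorm2 mulmx0 mxE.
Qed.

Lemma vnorm2_dotmx n (u : 'cV[C]_n) : (vnorm2 u)%:C = sqrtC (dotmx u^T u^T).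
Proof.
rewrite -[LHS]sqrCK ?ler0c ?vnorm2_ge0//.
rewrite -(rmorphXn (real_complex R)) /= sqr_vnorm2 dotmxE.
by rewrite !mxE; congr sqrtC; apply: eq_bigr => i _; rewrite !mxE mulrC.
Qed.

Lemma vnorm2D n (u w : 'cV[C]_n) : vnorm2 (u + w) <= vnorm2 u + vnorm2 w.
Proof.
rewrite -lecR rmorphD /= !vnorm2_dotmx linearD /=.
exact: (triangle_lerif (@dotmx C n)).
Qed.

Lemma vnorm2Z n (a : C) (u : 'cV[C]_n) : vnorm2 (a *: u) = normc a * vnorm2 u.
Proof.
apply: (@complexI R); rewrite rmorphM /= -norm_normc !vnorm2_dotmx linearZ /=.
by rewrite dnormZ sqrtCM ?nnegrE ?exprn_ge0 ?dnorm_ge0// sqrCK.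
Qed.

Lemma vnorm2_tens m n (u : 'cV[C]_m) (w : 'cV[C]_n) :
  vnorm2 (u *t w : 'cV_(m * n)) = vnorm2 u * vnorm2 w.
Proof.
apply: (pexpIrn (n := 2)); rewrite ?nnegrE ?mulr_ge0 ?vnorm2_ge0//.
apply: (@complexI R); rewrite exprMn [RHS]rmorphM /= !sqr_vnorm2.
have -> : (u *t w)^t* *m (u *t w) = (u^t* *m u) *t (w^t* *m w).
  by rewrite trmx_tens map_mxT tensmx_mul.
by rewrite [LHS]mxE !ord1.
Qed.

(** Through vectorization the Frobenius norm inherits the triangle inequality and homogeneity of
    [vnorm2]. *)
Lemma frobenius_normE n (B : 'M[C]_n) : frobenius_norm B = vnorm2 (mxvec B)^T.
Proof.
rewrite /frobenius_norm /vnorm2 (reindex _ (curry_mxvec_bij _ _)) /= pair_bigA /=.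
by congr Num.sqrt; apply: eq_bigr => -[i j] _; rewrite !mxE mxvecE.
Qed.

Lemma frobenius_norm_ge0 n (B : 'M[C]_n) : 0 <= frobenius_norm B.
Proof. exact: sqrtr_ge0. Qed.

Lemma sqr_frobenius_norm n (B : 'M[C]_n) :
  (frobenius_norm B ^+ 2)%:C = \tr (B^t* *m B).
Proof.
rewrite sqr_sqrtr; last by do 2!(apply: sumr_ge0 => ? _); exact: sqr_ge0.
rewrite exchange_big rmorph_sum; apply: eq_bigr => j _.
rewrite mxE rmorph_sum; apply: eq_bigr => i _.
by rewrite !mxE rmorphXn /= -norm_normc mulrC normCK.
Qed.

Lemma frobenius_normD n (A B : 'M[C]_n) :
  frobenius_norm (A + B) <= frobenius_norm A + frobenius_norm B.
Proof. by rewrite !frobenius_normE !linearD /= vnorm2D. Qed.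

Lemma frobenius_normZ n a (B : 'M[C]_n) :
  frobenius_norm (a *: B) = normc a * frobenius_norm B.
Proof. by rewrite !frobenius_normE !linearZ /= vnorm2Z. Qed.

Lemma adjmxM m n p (A : 'M[C]_(m, n)) (B : 'M[C]_(n, p)) :
  (A *m B)^t* = B^t* *m A^t*.
Proof. by rewrite trmx_mul map_mxM. Qed.

Lemma adjmxD m n (A B : 'M[C]_(m, n)) : (A + B)^t* = A^t* + B^t*.
Proof. by rewrite linearD /= map_mxD. Qed.

Lemma adjmxN m n (A : 'M[C]_(m, n)) : (- A)^t* = - A^t*.
Proof. by rewrite linearN /= map_mxN. Qed.

Lemma adjmxZ m n a (A : 'M[C]_(m, n)) : (a *: A)^t* = a^* *: A^t*.
Proof. by rewrite linearZ /= map_mxZ. Qed.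

Lemma frobenius_norm_adj n (B : 'M[C]_n) :
  frobenius_norm (B^t* ) = frobenius_norm B.
Proof.
rewrite /frobenius_norm exchange_big /=; congr Num.sqrt.
apply: eq_bigr => i _; apply: eq_bigr => j _; congr (_ ^+ 2).
by rewrite !mxE; apply: (@complexI R); rewrite -!norm_normc norm_conjC.
Qed.

Lemma sqr_frobenius_normD n (A B : 'M[C]_n) :
  \tr (A^t* *m B) = 0 ->
  frobenius_norm (A + B) ^+ 2 = frobenius_norm A ^+ 2 + frobenius_norm B ^+ 2.
Proof.
move=> AB0; have BA0 : \tr (B^t* *m A) = 0.
  rewrite -[B^t* *m A]trmxCK adjmxM trmxCK.
  by rewrite -[LHS]/(\tr (map_mx _ _)) trace_map_mx mxtrace_tr AB0 rmorph0.
apply: (@complexI R); rewrite [RHS]rmorphD /= !sqr_frobenius_norm.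
by rewrite adjmxD mulmxDl !mulmxDr !mxtraceD AB0 BA0 addr0 add0r.
Qed.

(** Pythagoras for the trace inner product. Frobenius minimality is obtained below by splitting a
    matrix into the candidate and an orthogonal remainder. *)
Lemma frobenius_norm_orthogonal n (A B : 'M[C]_n) :
  \tr (A^t* *m B) = 0 -> frobenius_norm A <= frobenius_norm (A + B).
Proof.
move=> /sqr_frobenius_normD AB.
by rewrite -(@ler_pXn2r _ 2) ?nnegrE ?frobenius_norm_ge0// AB lerDl sqr_ge0.
Qed.

Lemma outer_frobenius_norm n (s w : 'cV[C]_n) :
  vnorm2 w = 1 -> frobenius_norm (s *m w^t*) = vnorm2 s.
Proof.
move=> w1; apply: (pexpIrn (n := 2));
  rewrite ?nnegrE ?frobenius_norm_ge0 ?vnorm2_ge0//.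
apply: (@complexI R); rewrite sqr_frobenius_norm sqr_vnorm2.
rewrite adjmxM trmxCK mulmxA mxtrace_mulC !mulmxA -mulmxA.
rewrite -trace_mx11 (mx11_scalar (w^t* *m w)) -sqr_vnorm2 w1 expr1n.
by rewrite mul_scalar_mx scale1r.
Qed.
End Norms.

(** * Spectral norm, seminorms and a Cauchy-Schwarz bound *)

Section Spectral.
Variable R : realType.
Implicit Types (m n : nat).
Notation C := R[i].
Notation normc := (@Normc.normc R).

Lemma adj_mul_unit n (w : 'cV[C]_n) : vnorm2 w = 1 -> w^t* *m w = 1%:M.
Proof. by move=> w1; rewrite [LHS]mx11_scalar -sqr_vnorm2 w1 expr1n. Qed.

Lemma outer_orthogonal n (s w : 'cV[C]_n) (D : 'M[C]_n) :
  D *m w = 0 -> \tr ((s *m w^t*)^t* *m D) = 0.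
Proof.
by move=> Dw; rewrite adjmxM trmxCK -mulmxA mxtrace_mulC -mulmxA Dw mulmx0 mxtrace0.
Qed.

(** [B w w^*] has Frobenius norm |B w|, and the remainder [B - B w w^*] annihilates [w], hence is
    trace-orthogonal to it. *)
Lemma vnorm2_mul_le_frobenius n (B : 'M[C]_n) (w : 'cV[C]_n) :
  vnorm2 w = 1 -> vnorm2 (B *m w) <= frobenius_norm B.
Proof.
move=> w1; rewrite -(outer_frobenius_norm (B *m w) w1).
rewrite -[X in _ <= frobenius_norm X](subrK (B *m w *m w^t*)) addrC.
apply: frobenius_norm_orthogonal; apply: outer_orthogonal.
by rewrite mulmxBl -[_ *m w^t* *m w]mulmxA adj_mul_unit// mulmx1 subrr.
Qed.

Lemma vnorm2_mul_le_spectral n (B : 'M[C]_n) (w : 'cV[C]_n) :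
  vnorm2 w = 1 -> vnorm2 (B *m w) <= spectral_norm B.
Proof.
move=> w1; apply: ub_le_sup; last by exists w.
(* The Frobenius norm bounds the set, so its supremum is a genuine upper bound. *)
by exists (frobenius_norm B) => _ [u u1 <-]; exact: vnorm2_mul_le_frobenius.
Qed.

(** [w] witnesses that the set of values is nonempty, as bounding its supremum requires. *)
Lemma spectral_norm_le n (B : 'M[C]_n) (w : 'cV[C]_n) (r : R) :
  vnorm2 w = 1 -> (forall u : 'cV[C]_n, vnorm2 u = 1 -> vnorm2 (B *m u) <= r) ->
  spectral_norm B <= r.
Proof.
move=> w1 Br; apply: ge_sup => [|_ [u u1 <-]]; last exact: Br.
by exists (vnorm2 (B *m w)), w.
Qed.

(** Common interface of the two norms, so that backward errors are reduced once for both. *)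
Definition seminorm n (N : 'M[C]_n -> R) : Prop :=
  [/\ forall A, 0 <= N A, forall a A, N (a *: A) <= normc a * N A
    & forall A B, N (A + B) <= N A + N B].

Lemma frobenius_seminorm n : seminorm (@frobenius_norm R n).
Proof.
split=> [A|a A|A B]; first exact: frobenius_norm_ge0.
- by rewrite frobenius_normZ.
- exact: frobenius_normD.
Qed.

Lemma spectral_seminorm n (w : 'cV[C]_n) :
  vnorm2 w = 1 -> seminorm (@spectral_norm R n).
Proof.
move=> w1; split=> [A|a A|A B].
- exact: le_trans (vnorm2_ge0 _) (vnorm2_mul_le_spectral A w1).
- apply: (spectral_norm_le w1) => u u1.
  by rewrite -scalemxAl vnorm2Z ler_wpM2l ?normc_ge0 ?vnorm2_mul_le_spectral.
- apply: (spectral_norm_le w1) => u u1; rewrite mulmxDl.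
  by rewrite (le_trans (vnorm2D _ _))// lerD ?vnorm2_mul_le_spectral.
Qed.

Lemma sum_le_sqrt_sum_sqr n (a : 'I_n.+1 -> R) :
  \sum_i a i <= Num.sqrt n.+1%:R * Num.sqrt (\sum_i a i ^+ 2).
Proof.
set s := \sum_i a i; set q := \sum_i _; set N : R := n.+1%:R.
have N0 : 0 < N by rewrite ltr0n.
rewrite -sqrtrM ?(ltW N0)//; apply: (le_trans (ler_norm s)).
rewrite -sqrtr_sqr ler_wsqrtr//.
(* [N] times the sum of squared deviations from the mean [s / N] is [N q - s^2]. *)
have : 0 <= \sum_i (a i - s / N) ^+ 2 by apply: sumr_ge0 => i _; exact: sqr_ge0.
under eq_bigr do rewrite sqrrB.
rewrite big_split sumrB /= sumr_const card_ord -/q sumrMnl -mulr_suml -/s.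
rewrite -(mulr_natr (_ ^+ 2)) -/N -(pmulr_rge0 _ N0).
suff -> : N * (q - s * (s / N) *+ 2 + (s / N) ^+ 2 * N) = N * q - s ^+ 2.
  by rewrite subr_ge0.
by clearbody N s q; field; rewrite gt_eqF.
Qed.

End Spectral.

(** * Reduction of backward errors to minimal-norm solutions of [H w = s] *)

Section BackwardError.
Variable R : realType.
Implicit Types (m n : nat).
Notation C := R[i].
Notation normc := (@Normc.normc R).

Lemma normc_unit (z : C) : `|z| = 1 -> normc z = 1.
Proof. by move=> z1; apply: (@complexI R); rewrite -norm_normc z1. Qed.

Lemma seminorm_eval n m (N : 'M[C]_n -> R) (lam : C) (D : mxpol R m n) :
  seminorm N -> `|lam| = 1 ->
  N (mxpol_eval D lam) <= Num.sqrt m.+1%:R * mxpol_norm N D.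
Proof.
move=> [N0 NZ ND] lam1; apply: le_trans (sum_le_sqrt_sum_sqr _).
rewrite /mxpol_eval; elim/big_ind2: _ => [|A a B b Aa Bb|j _].
- by rewrite -[X in N X](scale0r 0) (le_trans (NZ _ _))// Normc.normc0 mul0r.
- exact: le_trans (ND _ _) (lerD Aa Bb).
- rewrite (le_trans (NZ _ _))// (normc_unit (z := _ ^+ _)) ?mul1r//.
  by rewrite normrX lam1 expr1n.
Qed.

Lemma conj_mul_unit (z : C) : `|z| = 1 -> z * z^* = 1.
Proof. by move=> z1; rewrite -normCK z1 expr1n. Qed.

(* The perturbation attaining the minimum spreads its value at [lam] evenly
   over the m + 1 coefficients, so that the triangle and Cauchy-Schwarz
   inequalities of [seminorm_eval] become equalities. *)
Definition spread m n (nu lam : C) (H : 'M[C]_n) : mxpol R m n :=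
  fun j => ((lam ^+ j)^* * nu^* / m.+1%:R) *: H.
Arguments spread m {n} nu lam H j.

Lemma spread_eval m n (nu lam : C) (H : 'M[C]_n) :
  `|lam| = 1 -> mxpol_eval (spread m nu lam H) lam = nu^* *: H.
Proof.
move=> lam1; rewrite /mxpol_eval /spread.
under eq_bigr => j _.
  rewrite scalerA !mulrA conj_mul_unit ?normrX ?lam1 ?expr1n// mul1r.
  over.
by rewrite sumr_const card_ord -scaler_nat scalerA mulrC mulfVK ?pnatr_eq0.
Qed.

(** Each coefficient has norm at most [N H / (m + 1)], and m + 1 such squares add up to
    [(N H)^2 / (m + 1)]. *)
Lemma spread_norm m n (N : 'M[C]_n -> R) (nu lam : C) (H : 'M[C]_n) :
  seminorm N -> `|lam| = 1 -> `|nu| = 1 ->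
  mxpol_norm N (spread m nu lam H) <= N H / Num.sqrt m.+1%:R.
Proof.
move=> [N0 NZ ND] lam1 nu1; have m0 : 0 < m.+1%:R :> R by rewrite ltr0n.
suff le1 j : N (spread m nu lam H j) <= N H / m.+1%:R.
  rewrite -[leRHS]ger0_norm ?divr_ge0 ?N0 ?sqrtr_ge0// -sqrtr_sqr ler_wsqrtr//.
  have -> : (N H / Num.sqrt m.+1%:R) ^+ 2 = \sum_(j < m.+1) (N H / m.+1%:R) ^+ 2.
    rewrite sumr_const card_ord -[RHS]mulr_natr !expr_div_n sqr_sqrtr ?ltW//.
    by rewrite [m.+1%:R ^+ 2]expr2 invfM mulrA mulfVK ?gt_eqF.
  apply: ler_sum => j _; rewrite ler_pXn2r ?nnegrE ?N0//.
  by rewrite divr_ge0 ?N0 ?ltW.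
rewrite (le_trans (NZ _ _))// mulrC ler_wpM2l ?N0// -lecR -norm_normc.
rewrite !normrM !norm_conjC normrX lam1 nu1 expr1n !mul1r normfV normr_nat.
by rewrite fmorphV rmorph_nat.
Qed.

(** [K] collects the values [nu D(lam)] for [D] in [S]. A feasible [D] yields a solution in [K] of
    the matrix equation, whose norm [seminorm_eval] controls; spreading the optimal [H0] attains the
    bound. *)
Lemma backward_error_spread m n (N : 'M[C]_n -> R) (S : set (mxpol R m n))
    (K : set 'M[C]_n) (nu lam : C) (w : 'cV[C]_n) (Q : mxpol R m n)
    (H0 : 'M[C]_n) :
  seminorm N -> `|lam| = 1 -> `|nu| = 1 ->
  (forall D, S D -> K (nu *: mxpol_eval D lam)) ->
  (forall H, K H -> S (spread m nu lam H)) ->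
  K H0 -> H0 *m w = - (nu *: mxpol_eval Q lam) *m w ->
  (forall H, K H -> H *m w = - (nu *: mxpol_eval Q lam) *m w -> N H0 <= N H) ->
  backward_error N S lam w Q = N H0 / Num.sqrt m.+1%:R.
Proof.
move=> sN lam1 nu1 SK KS KH0 H0w H0min; have [N0 NZ ND] := sN.
have lb D : S D -> mxpol_eval Q lam *m w + mxpol_eval D lam *m w = 0 ->
    N H0 / Num.sqrt m.+1%:R <= mxpol_norm N D.
  move=> SD QD; rewrite ler_pdivrMr ?sqrtr_gt0 ?ltr0n// mulrC.
  apply: le_trans (seminorm_eval D sN lam1).
  apply: (le_trans (H0min _ (SK _ SD) _)).
    by rewrite mulNmx -!scalemxAl -(addr0_eq QD) scalerN.
  by rewrite (le_trans (NZ _ _))// normc_unit// mul1r.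
have QH0 : mxpol_eval Q lam *m w + mxpol_eval (spread m nu lam H0) lam *m w = 0.
  rewrite spread_eval// -scalemxAl H0w mulNmx -scalemxAl scalerN scalerA.
  by rewrite mulrC conj_mul_unit// scale1r subrr.
apply: minimumE; split; last by move=> _ [D [SD QD] <-]; exact: lb.
exists (spread m nu lam H0); first by split=> //; exact: KS.
by apply/eqP; rewrite eq_le spread_norm//= lb//; exact: KS.
Qed.

(** The constraint is homogeneous in [w], so [w] may be normalized. *)
Lemma backward_errorZ m n (N : 'M[C]_n -> R) (S : set (mxpol R m n)) (lam a : C)
    (w : 'cV[C]_n) (Q : mxpol R m n) :
  a != 0 -> backward_error N S lam (a *: w) Q = backward_error N S lam w Q.
Proof.
move=> a0; congr (minimum (_ @` _)); apply/funext => D; apply/propext.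
rewrite /= -!scalemxAr -scalerDr; split=> -[SD /eqP]; last first.
  by move=> /eqP ->; rewrite scaler0.
by rewrite scaler_eq0 (negbTE a0) => /eqP.
Qed.

End BackwardError.

Arguments spread {R} m {n} nu lam H j.

(** * Hermitian solutions of [H w = s] of least norm *)

Section Hermitian.
Variable R : realType.
Implicit Types (m n : nat).
Notation C := R[i].
Notation normc := (@Normc.normc R).

Lemma spectral_le_frobenius n (B : 'M[C]_n) (w : 'cV[C]_n) :
  vnorm2 w = 1 -> spectral_norm B <= frobenius_norm B.
Proof.
move=> w1; apply: (spectral_norm_le w1) => u u1.
exact: vnorm2_mul_le_frobenius.
Qed.

(* With [t = s - (w^* s) w] orthogonal to [w], the minimiser is
   [s w^* + w t^*]. *)
Lemma hermitian_frobenius_min n (s w : 'cV[C]_n) :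
  vnorm2 w = 1 -> s^t* *m w = w^t* *m s ->
  exists H0 : 'M[C]_n,
    [/\ H0^t* = H0, H0 *m w = s,
        forall H : 'M[C]_n, H^t* = H -> H *m w = s ->
          frobenius_norm H0 <= frobenius_norm H
      & frobenius_norm H0 <= Num.sqrt 2 * vnorm2 s].
Proof.
move=> w1 sw; pose t := s - w *m (w^t* *m s).
have wt : w^t* *m t = 0.
  by rewrite mulmxBr mulmxA adj_mul_unit// mul1mx subrr.
have tw : t^t* *m w = 0 by rewrite -[w]trmxCK -adjmxM wt trmx0 map_mx0.
pose H0 := s *m w^t* + w *m t^t*.
have H0w : H0 *m w = s.
  by rewrite mulmxDl -!mulmxA adj_mul_unit// tw mulmx1 mulmx0 addr0.
have H0H : H0^t* = H0.
  (* As [w^* s] is real, both [H0] and its adjoint equal [s w^* + w s^* - (w^* s) w w^*]. *)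
  have tH : t^t* = s^t* - (w^t* *m s) *m w^t*.
    by rewrite /t adjmxD adjmxN !adjmxM trmxCK sw.
  rewrite /H0 adjmxD !adjmxM !trmxCK tH mulmxBr mulmxBl !mulmxA.
  by rewrite addrCA addrA.
exists H0; split=> // [H HH Hw|].
  rewrite -[X in _ <= frobenius_norm X](subrK H0) addrC.
  apply: frobenius_norm_orthogonal.
  (* The difference of two Hermitian solutions annihilates [w] from both sides, so it is orthogonal
     to both summands of [H0]. *)
  have Bw : (H - H0) *m w = 0 by rewrite mulmxBl Hw H0w subrr.
  have wB : w^t* *m (H - H0) = 0.
    by rewrite -[H - H0]trmxCK -adjmxM adjmxD adjmxN HH H0H Bw trmx0 map_mx0.
  rewrite {1}/H0 adjmxD mulmxDl mxtraceD [X in X + _](outer_orthogonal s Bw) add0r.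
  by rewrite adjmxM trmxCK -mulmxA wB mulmx0 mxtrace0.
(* Passing to [t w^*] and [s w^*] lets the matrix form of Pythagoras apply to vectors. *)
have ts : vnorm2 t <= vnorm2 s.
  rewrite -(outer_frobenius_norm t w1) -(outer_frobenius_norm s w1).
  rewrite -[X in _ <= frobenius_norm X](subrK (t *m w^t*)) addrC -mulmxBl.
  apply: frobenius_norm_orthogonal; rewrite opprB addrC subrK.
  by rewrite adjmxM trmxCK -!mulmxA (mulmxA (t^t*)) tw mul0mx mulmx0 mxtrace0.
have wtt : frobenius_norm (w *m t^t*) = vnorm2 t.
  rewrite -(outer_frobenius_norm t w1) -[RHS]frobenius_norm_adj.
  by rewrite adjmxM trmxCK.
(* The summands of [H0] are orthogonal, so its squared norm is |s|^2 + |t|^2, at most 2 |s|^2. *)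
rewrite -(@ler_pXn2r _ 2) ?nnegrE ?mulr_ge0 ?frobenius_norm_ge0 ?sqrtr_ge0//.
rewrite sqr_frobenius_normD; last first.
  by rewrite adjmxM trmxCK mxtrace_mulC mulmxA -(mulmxA w) tw mulmx0 mul0mx mxtrace0.
rewrite outer_frobenius_norm// wtt exprMn.
rewrite (sqr_sqrtr (ler0n _ 2)) mulr_natl mulr2n lerD2l.
by rewrite ler_pXn2r ?nnegrE ?vnorm2_ge0.
Qed.

(* A multiple of the Householder reflection exchanging [w] and [s / |s|]; when
   [d = 0] the coefficient [c] is a division by zero, hence 0. *)
Lemma hermitian_spectral_min n (s w : 'cV[C]_n) :
  vnorm2 w = 1 -> s^t* *m w = w^t* *m s ->
  exists H0 : 'M[C]_n,
    [/\ H0^t* = H0, H0 *m w = s & spectral_norm H0 <= vnorm2 s].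
Proof.
move=> w1 sw; pose r : C := (vnorm2 s)%:C; pose d := r *: w - s.
have rr : r^* = r by exact: conjc_real.
pose q : C := (vnorm2 d ^+ 2)%:C; pose c := (2 * r) / q.
have qq : q^* = q by exact: conjc_real.
have dd : d^t* *m d = q%:M by rewrite [LHS]mx11_scalar /q sqr_vnorm2.
have cc : c^* = c by rewrite /c fmorph_div rmorphM /= rmorph_nat rr qq.
have ss : s^t* *m s = (r ^+ 2)%:M.
  by rewrite [LHS]mx11_scalar -sqr_vnorm2 /r rmorphXn.
(* Since |s| = r and [w^* s] is real, |d|^2 = 2 r (r - w^* s). This is why the choice of [c] gives
   [H0 w = r w - d = s]. *)
have dw : (2 * r) *: (d^t* *m w) = q%:M.
  rewrite -dd /d adjmxD adjmxN adjmxZ rr mulmxDr !mulmxDl !mulNmx -!scalemxAl.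
  rewrite !mulmxN -!scalemxAr adj_mul_unit// ss sw.
  rewrite (mx11_scalar (w^t* *m s)); set a := _ 0 0.
  by apply/matrixP => i j; rewrite !ord1 !mxE eqxx !mulr1n; ring.
pose H0 := r%:M - c *: (d *m d^t*).
have H0H : H0^t* = H0.
  rewrite /H0 adjmxD adjmxN adjmxZ cc adjmxM trmxCK; congr (_ - _).
  by rewrite tr_scalar_mx map_scalar_mx /= rr.
have H0w : H0 *m w = s.
  rewrite mulmxBl mul_scalar_mx -scalemxAl -mulmxA.
  rewrite /c mulrC -scalerA scalemxAr dw mul_mx_scalar scalerA.
  have [q0|q0] := eqVneq q 0; last by rewrite mulVf// scale1r opprB addrC subrK.
  have d0 : d = 0.
    apply/eqP; rewrite -vnorm2_eq0 -sqrf_eq0; apply/eqP/(@complexI R).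
    exact: q0.
  by rewrite d0 scaler0 subr0; apply/eqP; rewrite -subr_eq0 -/d d0.
exists H0; split=> //; apply: (spectral_norm_le w1) => u u1.
(* [H0] is [r] times a unitary matrix, hence scales every length by [r]. *)
have HH : H0^t* *m H0 = (r ^+ 2)%:M.
  have ccq : c * (c * q) = 2 * r * c.
    rewrite /c; have [->|q0] := eqVneq q 0; first by rewrite invr0 !mulr0.
    by rewrite divfK// mulrC.
  have DD : (d *m d^t*) *m (d *m d^t*) = q *: (d *m d^t*).
    by rewrite mulmxA -(mulmxA d) dd mul_mx_scalar -scalemxAl.
  rewrite H0H {1}/H0 mulmxBl mul_scalar_mx -scalemxAl mulmxBr mul_mx_scalar.
  rewrite -scalemxAr DD /H0; move: (d *m d^t*) => D.
  rewrite !scalerBr !scalerA -mulrA ccq scale_scalar_mx -expr2.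
  rewrite opprB addrAC -scalerBl -addrA -scalerBl.
  by rewrite (mulrC c) -[2 * r * c]mulrA mulr_natl mulr2n addrK subrr scale0r addr0.
rewrite -(@ler_pXn2r _ 2) ?nnegrE ?vnorm2_ge0// -lecR sqr_vnorm2 adjmxM -mulmxA.
rewrite (mulmxA (H0^t*)) HH mul_scalar_mx -scalemxAr adj_mul_unit// mxE mxE mulr1.
by rewrite /r rmorphXn.
Qed.

End Hermitian.

(** * Palindromic and anti-palindromic polynomials on the unit circle *)

Section Palindromic.
Variable R : realType.
Implicit Types (m n : nat).
Notation C := R[i].

(* [eps = 1] is the H-palindromic and [eps = -1] the H-anti-palindromic
   structure. *)
Definition palindromic m n (eps : C) : set (mxpol R m n) :=
  [set Q | forall j, Q j ^t* = eps *: Q (rev_ord j)].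

Lemma Hpalindromic_palindromic m n : @Hpalindromic R m n = palindromic 1.
Proof. by apply/seteqP; split=> Q hQ j; rewrite hQ scale1r. Qed.

Lemma Hantipalindromic_palindromic m n :
  @Hantipalindromic R m n = palindromic (-1).
Proof. by apply/seteqP; split=> Q hQ j; rewrite hQ scaleN1r. Qed.

Variables (m n : nat) (eps lam : C).
Hypotheses (eps1 : `|eps| = 1) (lam1 : `|lam| = 1).

(* A square root of [eps / lam ^ m]: multiplying by it makes the value at [lam]
   of a structured polynomial Hermitian. *)
Let nu : C := sqrtC (eps * (lam^* ) ^+ m).

Let sqr_nu : nu ^+ 2 = eps * (lam^* ) ^+ m.
Proof. exact: sqrtCK. Qed.

Let nu1 : `|nu| = 1.
Proof.
apply: (pexpIrn (n := 2)); rewrite ?nnegrE// -normrX sqr_nu normrM normrX.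
by rewrite norm_conjC eps1 lam1 mul1r !expr1n.
Qed.

Let conj_lam_exp k : (lam^* ) ^+ k * lam ^+ k = 1.
Proof. by rewrite -exprMn mulrC conj_mul_unit// expr1n. Qed.

Let conj_lam_sub k : (k <= m)%N ->
  (lam^* ) ^+ m * lam ^+ (m - k) = (lam^* ) ^+ k.
Proof. by move=> km; rewrite -{1}(subnKC km) exprD -mulrA conj_lam_exp mulr1. Qed.

Let conj_nu_sqr : nu^* * nu ^+ 2 = nu.
Proof. by rewrite expr2 mulrA [nu^* * nu]mulrC conj_mul_unit// mul1r. Qed.

(** Reversing the sum gives [Q(lam)^* = eps lam^(-m) Q(lam) = nu^2 Q(lam)], and
    [conj(nu) nu^2 = nu]. *)
Lemma palindromic_eval_hermitian (Q : mxpol R m n) : palindromic eps Q ->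
  (nu *: mxpol_eval Q lam)^t* = nu *: mxpol_eval Q lam.
Proof.
move=> hQ; rewrite adjmxZ -[in RHS]conj_nu_sqr sqr_nu -scalerA; congr (_ *: _).
rewrite /mxpol_eval linear_sum map_mx_sum scaler_sumr.
rewrite [RHS](reindex_inj rev_ord_inj) /=; apply: eq_bigr => j _.
rewrite adjmxZ hQ !scalerA; congr (_ *: _).
rewrite rmorphXn /= -mulrA mulrC; congr (_ * _).
by rewrite subSS conj_lam_sub// -ltnS.
Qed.

(** The weights must satisfy [lam^j nu = eps conj(lam)^(m-j) conj(nu)], which follows from
    [nu = conj(nu) eps conj(lam)^m]. *)
Lemma spread_palindromic (H : 'M[C]_n) :
  H^t* = H -> palindromic eps (spread m nu lam H).
Proof.
move=> HH j; rewrite adjmxZ HH scalerA; congr (_ *: _).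
rewrite !rmorphM /= fmorphV /= rmorph_nat !conjCK mulrA; congr (_ / _).
rewrite subSS -{1}conj_nu_sqr sqr_nu rmorphXn /=.
rewrite -(conj_lam_sub (leq_subr j m)) subKn -1?ltnS//.
by move: (lam ^+ j) (_ ^+ m) (nu^* ) => a b c; ring.
Qed.

Section UnitVector.
Variables (w : 'cV[C]_n) (Q : mxpol R m n).
Hypothesis w1 : vnorm2 w = 1.

Let e := vnorm2 (mxpol_eval Q lam *m w) / Num.sqrt m.+1%:R.
Let s := - (nu *: mxpol_eval Q lam) *m w.

Let norm_s : vnorm2 s = vnorm2 (mxpol_eval Q lam *m w).
Proof. by rewrite /s -scaleNr -scalemxAl vnorm2Z normc_unit ?mul1r// normrN. Qed.

(** The rank-one matrix [s w^*] solves the equation, and its Frobenius norm |s| equals the lower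
    bound |H w| valid for every solution [H]. *)
Lemma unstructured_backward_error_unit (N : 'M[C]_n -> R) :
  seminorm N -> (forall B, vnorm2 (B *m w) <= N B) ->
  (forall B, N B <= frobenius_norm B) ->
  backward_error N setT lam w Q = e.
Proof.
move=> sN lb ub.
have sww : s *m w^t* *m w = s by rewrite -mulmxA adj_mul_unit// mulmx1.
have Ns : N (s *m w^t*) = vnorm2 s.
  apply/eqP; rewrite eq_le -{1}(outer_frobenius_norm s w1) ub /=.
  by have := lb (s *m w^t*); rewrite sww.
have -> := backward_error_spread (S := setT) (K := setT) sN lam1 nu1
  (fun _ _ => I) (fun _ _ => I) I sww.
- by rewrite Ns norm_s.
- by move=> H _ Hw; rewrite Ns /s -Hw.
Qed.

Hypothesis hQ : palindromic eps Q.

(** A Hermitian solution requires [w^* s] to be real; here [s = - A w] with [A] Hermitian. *)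
Let adj_s_mul : s^t* *m w = w^t* *m s.
Proof.
rewrite /s mulNmx mulmxN adjmxN mulNmx adjmxM palindromic_eval_hermitian//.
by rewrite mulmxA.
Qed.

Lemma palindromic_spectral_error_unit :
  backward_error (@spectral_norm R n) (palindromic eps) lam w Q = e.
Proof.
have [H0 [HH Hw Hs]] := hermitian_spectral_min w1 adj_s_mul.
have le_s H : H *m w = s -> vnorm2 s <= spectral_norm H.
  by move=> <-; exact: vnorm2_mul_le_spectral.
have -> := backward_error_spread (K := [set H | H^t* = H])
  (spectral_seminorm w1) lam1 nu1 palindromic_eval_hermitian
  spread_palindromic HH Hw.
- by congr (_ / _); rewrite -norm_s; apply/eqP; rewrite eq_le Hs le_s.
- by move=> H _ /le_s; exact: le_trans.
Qed.

Lemma palindromic_frobenius_error_unit :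
  e <= backward_error (@frobenius_norm R n) (palindromic eps) lam w Q
    <= Num.sqrt 2 * e.
Proof.
have [H0 [HH Hw Hmin Hs]] := hermitian_frobenius_min w1 adj_s_mul.
have -> := backward_error_spread (K := [set H | H^t* = H])
  (@frobenius_seminorm R n) lam1 nu1 palindromic_eval_hermitian
  spread_palindromic HH Hw Hmin.
rewrite /e mulrA !ler_pM2r ?invr_gt0 ?sqrtr_gt0 ?ltr0n// -norm_s Hs andbT.
by rewrite -{1}Hw; exact: vnorm2_mul_le_frobenius.
Qed.

End UnitVector.
End Palindromic.

(** * Vectors of arbitrary nonzero norm, by scaling *)

Section GeneralVector.
Variable R : realType.
Notation C := R[i].
Variables (m n : nat) (eps lam : C) (w : 'cV[C]_n) (Q : mxpol R m n).
Hypotheses (eps1 : `|eps| = 1) (lam1 : `|lam| = 1).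
Hypotheses (w0 : vnorm2 w != 0) (hQ : palindromic eps Q).

Let a : C := (vnorm2 w)^-1%:C.

Let a0 : a != 0.
Proof. by rewrite (inj_eq (@complexI R) _ 0) invr_eq0. Qed.

Let normc_a : Normc.normc a = (vnorm2 w)^-1.
Proof.
by apply: (@complexI R); rewrite -norm_normc ger0_norm// ler0c invr_ge0 vnorm2_ge0.
Qed.

Let aw1 : vnorm2 (a *: w) = 1.
Proof. by rewrite vnorm2Z normc_a mulVf. Qed.

Let Qaw : vnorm2 (mxpol_eval Q lam *m (a *: w))
  = vnorm2 (mxpol_eval Q lam *m w) / vnorm2 w.
Proof. by rewrite -scalemxAr vnorm2Z normc_a mulrC. Qed.

Let e := vnorm2 (mxpol_eval Q lam *m w) / vnorm2 w / Num.sqrt m.+1%:R.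

Lemma palindromic_spectral_error :
  backward_error (@spectral_norm R n) (palindromic eps) lam w Q = e.
Proof.
by rewrite -(backward_errorZ _ _ _ _ _ a0) palindromic_spectral_error_unit// Qaw.
Qed.

Lemma palindromic_frobenius_error :
  e <= backward_error (@frobenius_norm R n) (palindromic eps) lam w Q
    <= Num.sqrt 2 * e.
Proof.
rewrite -(backward_errorZ _ _ _ _ _ a0) /e -Qaw.
exact: palindromic_frobenius_error_unit.
Qed.

End GeneralVector.

(** * Ansatz equation and comparison of the backward errors *)

Lemma vnorm2_Lam (R : realType) (m : nat) (lam : R[i]) :
  `|lam| = 1 -> vnorm2 (Lam m lam) = Num.sqrt m%:R.
Proof.
move=> lam1; rewrite /vnorm2; under eq_bigr => i _.
  rewrite mxE normc_unit ?normrX ?lam1 ?expr1n//.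
  over.
by rewrite sumr_const card_ord.
Qed.

(** Multiplying the ansatz equation on the right by [1 *t x] relates the two residuals. *)
Lemma L1_eval (R : realType) (m n : nat) (P : mxpol R m n)
    (L : mxpol R 1 (m * n)) (v : 'cV[R[i]]_m) (lam : R[i]) (x : 'cV[R[i]]_n) :
  in_L1 P L v ->
  mxpol_eval L lam *m (Lam m lam *t x) = v *t (mxpol_eval P lam *m x).
Proof.
move=> PL; have := PL lam; move/(congr1 (mulmx^~ ((1%:M : 'M_1) *t x))).
by rewrite /= -mulmxA !tensmx_mul !mul1mx !mulmx1.
Qed.

Theorem theorem4p5 (R : realType) (m n : nat) (P : mxpol R m n)
    (hreg : regular P) (hP : Hpalindromic P)
    (L : mxpol R 1 (m * n)) (v : 'cV[R[i]]_m)
    (hL1 : in_L1 P L v) (hlin : linearization P L) (hv : vnorm2 v = 1)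
    (S : set (mxpol R 1 (m * n))) (hLS : S L)
    (hS : S = @Hpalindromic R 1 (m * n)
            /\ flip_mx R m *m v = map_mx Num.conj v
          \/ S = @Hantipalindromic R 1 (m * n)
            /\ flip_mx R m *m v = - map_mx Num.conj v)
    (lam : R[i]) (hlam : `|lam| = 1)
    (x : 'cV[R[i]]_n) (hx : vnorm2 x = 1)
    (hPx : mxpol_eval P lam *m x != 0) :
  let w : 'cV[R[i]]_(m * n) := Lam m lam *t x in
  let Sp : set (mxpol R m n) := @Hpalindromic R m n in
  let etaF_L := backward_error (@frobenius_norm R (m * n)) S lam w L in
  let etaF_P := backward_error (@frobenius_norm R n) setT lam x P in
  let etaF_Sp := backward_error (@frobenius_norm R n) Sp lam x P in
  let eta2_L := backward_error (@spectral_norm R (m * n)) S lam w L in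
  let eta2_P := backward_error (@spectral_norm R n) setT lam x P in
  let eta2_Sp := backward_error (@spectral_norm R n) Sp lam x P in
  let c : R := Num.sqrt ((m + 1)%:R / (2 * m)%:R) in
  [/\ c <= etaF_L / etaF_P <= Num.sqrt 2,
      etaF_L / etaF_Sp <= Num.sqrt 2,
      c <= eta2_L / eta2_P,
      eta2_L / eta2_P = eta2_L / eta2_Sp
    & eta2_L / eta2_Sp <= Num.sqrt 2].
Proof.
move=> w Sp etaF_L etaF_P etaF_Sp eta2_L eta2_P eta2_Sp c.
(* For m = 0 the vector [v] would be empty, of norm 0. *)
have m0 : (0 < m)%N.
  rewrite lt0n; apply/eqP => mE; have /eqP := hv; rewrite /vnorm2 big1 ?sqrtr0.
    by rewrite eq_sym oner_eq0.
  by move=> i; have := ltn_ord i; rewrite [X in (_ < X)%N]mE.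
pose r := vnorm2 (mxpol_eval P lam *m x).
pose eP := r / Num.sqrt m.+1%:R.
have r0 : 0 < r by rewrite lt_def vnorm2_eq0 hPx vnorm2_ge0.
have eP0 : 0 < eP by rewrite divr_gt0// sqrtr_gt0 ltr0n.
have norm_w : vnorm2 w = Num.sqrt m%:R by rewrite vnorm2_tens hx mulr1 vnorm2_Lam.
have norm_Lw : vnorm2 (mxpol_eval L lam *m w) = r.
  by rewrite (L1_eval _ _ hL1) vnorm2_tens hv mul1r.
have c1 : c <= 1.
  rewrite -[leRHS]sqrtr1 ler_wsqrtr// ler_pdivrMr ?ltr0n ?muln_gt0// mul1r ler_nat.
  by rewrite mul2n -addnn leq_add2l.
(* The left side is the error level of the pencil: [w] has norm sqrt m and grade 1 means two
   coefficients, against m + 1 for [P]. *)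
have eLP : r / Num.sqrt m%:R / Num.sqrt 2 = c * eP.
  rewrite /c /eP natrM addn1 sqrtrM ?ler0n// sqrtrV ?mulr_ge0// sqrtrM//.
  by field; rewrite !gt_eqF ?sqrtr_gt0 ?ltr0n.
have [eps eps1 Seps] : exists2 eps : R[i], `|eps| = 1 & S = palindromic eps.
  case: hS => -[-> _].
    by exists 1; rewrite ?normr1// Hpalindromic_palindromic.
  by exists (-1); rewrite ?normrN1// Hantipalindromic_palindromic.
have w0 : vnorm2 w != 0 by rewrite norm_w gt_eqF// sqrtr_gt0 ltr0n.
have LS : palindromic eps L by rewrite -Seps.
have PS : palindromic 1 P by rewrite -Hpalindromic_palindromic.
have one1 : `|1 : R[i]| = 1 := normr1 _.
have eta2_LE : eta2_L = c * eP.
  by rewrite /eta2_L Seps palindromic_spectral_error// norm_Lw norm_w.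
have [etaF_L1 etaF_L2] : c * eP <= etaF_L /\ etaF_L <= Num.sqrt 2 * (c * eP).
  apply/andP; rewrite -eLP -norm_w -norm_Lw /etaF_L Seps.
  exact: palindromic_frobenius_error.
have etaF_PE : etaF_P = eP.
  apply: (unstructured_backward_error_unit one1) => //.
  - exact: frobenius_seminorm.
  - by move=> B; exact: vnorm2_mul_le_frobenius.
have eta2_PE : eta2_P = eP.
  apply: (unstructured_backward_error_unit one1) => //.
  - exact: spectral_seminorm hx.
  - by move=> B; exact: vnorm2_mul_le_spectral.
  - by move=> B; exact: spectral_le_frobenius hx.
have eta2_SpE : eta2_Sp = eP.
  by rewrite /eta2_Sp /Sp Hpalindromic_palindromic palindromic_spectral_error_unit.
(* A lower bound suffices, since [etaF_Sp] occurs only as a denominator. *)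
have etaF_Sp1 : eP <= etaF_Sp.
  rewrite /etaF_Sp /Sp Hpalindromic_palindromic.
  by have /andP[] := palindromic_frobenius_error_unit one1 hlam hx PS.
have etaF_L_le : etaF_L <= Num.sqrt 2 * eP.
  rewrite (le_trans etaF_L2)// ler_wpM2l ?sqrtr_ge0// ler_piMl//.
  exact: ltW.
rewrite etaF_PE eta2_LE eta2_PE eta2_SpE mulfK ?gt_eqF//; split=> //.
- by rewrite ler_pdivlMr// ler_pdivrMr// etaF_L1.
- rewrite ler_pdivrMr ?(lt_le_trans eP0)//.
  by rewrite (le_trans etaF_L_le)// ler_wpM2l ?sqrtr_ge0.
(* In the spectral norm the ratio is exactly [c], which is at most 1. *)
- by rewrite (le_trans c1)// -[leLHS]sqrtr1 ler_wsqrtr// ler1n.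
Qed.
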